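(* Let $E$ and $B$ be finite $T_0$-spaces with $E\neq\varnothing$ and let $p\colon E\to B$ be a Hurewicz fibration which admits a regular path-lifting map. Then $p$ is a Grothendieck bifibration.
   Context: A finite $T_0$-space is regarded as a poset via $x\leq y$ iff $U_x\subseteq U_y$, where $U_a$ is the smallest open set containing $a$; a poset is regarded as a small category (with one arrow $x\to y$ exactly when $x\leq y$), and continuous (i.e. order-preserving) maps as functors. A Hurewicz fibration is a continuous map with the homotopy lifting property with respect to all topological spaces. Let $I=[0,1]$, let $B^I,E^I$ have the compact-open topology, and let $E\times_p B^I=\{(e,\gamma)\in E\times B^I: \gamma(0)=p(e)\}$. A path-lifting map for $p$ is a continuous map $\Lambda\colon E\times_p B^I\to E^I$ such that $\Lambda(e,\gamma)(0)=e$ and $p\circ\Lambda(e,\gamma)=\gamma$ for all $(e,\gamma)$. It is regular if $\Lambda(e,\gamma)$ is the constant path at $e$ whenever $\gamma$ is the constant path at $p(e)$. A functor $p\colon E\to B$ between small categories is a Grothendieck fibration if for all $e\in E$ and all arrows $f\colon b\to p(e)$ of $B$ there is a cartesian arrow $\tilde f\colon e'\to e$ of $E$ with $p(\tilde f)=f$; here an arrow $f\colon e'\to e$ is cartesian if for all $g\colon e''\to e$ in $E$ and $h\colon p(e'')\to p(e')$ in $B$ with $p(g)=p(f)h$ there is a unique $\tilde h\colon e''\to e'$ with $f\tilde h=g$ and $p(\tilde h)=h$. It is a Grothendieck opfibration if $p^{\mathrm{op}}$ is a Grothendieck fibration, and a Grothendieck bifibration if it is both. *)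

(* Defs.v *)
From HB Require Import structures.
From mathcomp Require Import all_boot all_order all_algebra.
From mathcomp Require Import all_classical all_reals all_analysis.

Set Implicit Arguments.
Unset Strict Implicit.
Unset Printing Implicit Defensive.

Import Order.TTheory GRing.Theory Num.Theory.
Import numFieldNormedType.Exports.
(* The types [continuousType U V] carry the compact-open topology. *)
Import ArrowAsCompactOpen.

Local Open Scope classical_set_scope.
Local Open Scope ring_scope.

Record category : Type := Category {
  obj :> Type;
  hom : obj -> obj -> Type;
  idm : forall a, hom a a;
  comp : forall a b c, hom b c -> hom a b -> hom a c;
  comp_idl : forall a b (f : hom a b), comp (idm b) f = f;
  comp_idr : forall a b (f : hom a b), comp f (idm a) = f;
  comp_assoc : forall a b c d (h : hom c d) (g : hom b c) (f : hom a b),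
    comp h (comp g f) = comp (comp h g) f
}.
Arguments hom {C} a b : rename.
Arguments idm {C} a : rename.
Arguments comp {C a b c} g f : rename.

Record functor (C D : category) : Type := Functor {
  fobj :> C -> D;
  fmap : forall a b : C, hom a b -> hom (fobj a) (fobj b);
  fmap_id : forall a : C, fmap (idm a) = idm (fobj a);
  fmap_comp : forall (a b c : C) (g : hom b c) (f : hom a b),
    fmap (comp g f) = comp (fmap g) (fmap f)
}.

Definition op (C : category) : category := {|
  obj := C;
  hom := fun a b => @hom C b a;
  idm := fun a => @idm C a;
  comp := fun a b c g f => comp f g;
  comp_idl := fun a b f => comp_idr f;
  comp_idr := fun a b f => comp_idl f;
  comp_assoc := fun a b c d h g f => esym (comp_assoc f g h)
|}.

Definition fop (C D : category) (F : functor C D) : functor (op C) (op D) :=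
  @Functor (op C) (op D) F (fun a b f => fmap F f) (fmap_id F)
    (fun a b c g f => fmap_comp F f g).

Definition cartesian (E B : category) (p : functor E B) (e' e : E)
    (f : hom e' e) : Prop :=
  forall (e'' : E) (g : hom e'' e) (h : hom (p e'') (p e')),
    fmap p g = comp (fmap p f) h ->
    exists! ht : hom e'' e', comp f ht = g /\ fmap p ht = h.

(* The equation p(ft) = f also says that both arrows have the same domain,
   so it is an equality in the type of all arrows with codomain [p e]. *)
Definition grothendieck_fibration (E B : category) (p : functor E B) : Prop :=
  forall (e : E) (b : B) (f : hom b (p e)),
    exists (e' : E) (ft : hom e' e),
      cartesian p ft /\
      existT (fun c : B => hom c (p e)) (p e') (fmap p ft)
        = existT (fun c : B => hom c (p e)) b f.

Definition grothendieck_opfibration (E B : category) (p : functor E B) : Prop :=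
  grothendieck_fibration (fop p).

Definition grothendieck_bifibration (E B : category) (p : functor E B) : Prop :=
  grothendieck_fibration p /\ grothendieck_opfibration p.

(* U_a: by [open_min_open], the smallest open set containing a when X is
   finite. *)
Definition min_open (X : topologicalType) (a : X) : set X :=
  \bigcap_(U in [set U : set X | open U /\ U a]) U.

Definition space_le (X : topologicalType) (x y : X) : Prop :=
  min_open x `<=` min_open y.

Lemma min_open_self (X : topologicalType) (a : X) : min_open a a.
Proof. by move=> U []. Qed.

Lemma min_open_sub (X : topologicalType) (a : X) (U : set X) :
  open U -> U a -> min_open a `<=` U.
Proof. by move=> oU Ua x; apply; split. Qed.

Lemma open_min_open (X : topologicalType) (a : X) :
  finite_set [set: X] -> open (min_open a).
Proof.
move=> finX.
have /choice[V VP] (x : X) : exists U : set X,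
    [/\ open U, U a & ~ min_open a x -> ~ U x].
  have [ax|] := pselect (min_open a x).
    by exists setT; split=> //; exact: openT.
  by move=> /existsNP[U /not_implyP[[oU Ua] Ux]]; exists U; split.
suff -> : min_open a = \bigcap_(x in [set: X]) V x.
  rewrite -bigsetI_fset_set//; elim/big_ind: _ => [||x _].
  - exact: openT.
  - exact: openI.
  - by have [] := VP x.
rewrite eqEsubset; split=> [y ay x _|y Vy].
  by have [oV Va _] := VP x; exact: min_open_sub Va y ay.
apply: contrapT => ay; have [_ _ /(_ ay)] := VP y; apply; exact: Vy.
Qed.

Lemma space_le_refl (X : topologicalType) (x : X) : space_le x x.
Proof. exact. Qed.

Lemma space_le_trans (X : topologicalType) (y x z : X) :
  space_le x y -> space_le y z -> space_le x z.
Proof. exact: subset_trans. Qed.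

Lemma space_le_anti (X : topologicalType) (x y : X) :
  kolmogorov_space X -> space_le x y -> space_le y x -> x = y.
Proof.
move=> T0 xy yx; apply/eqP; apply: contrapT => /negP /T0[A].
suff H (a b : X) : space_le b a -> A \in nbhs a -> b \in ~` A -> False.
  by case=> -[]; [exact: H yx|exact: H xy].
move=> ba; rewrite !inE /= => Aa; apply; apply: interior_subset.
exact: (min_open_sub (@open_interior X A) Aa (ba b (@min_open_self X b))).
Qed.

Lemma space_le_continuous (X Y : topologicalType) (p : continuousType X Y)
  (x y : X) : space_le x y -> space_le (p x) (p y).
Proof.
move=> xy z pxz V [oV Vpy]; apply: pxz; split=> //.
have oU : open (p @^-1` V) by apply: open_comp => // t _; exact: cts_fun.
exact: (min_open_sub oU Vpy (xy x (@min_open_self X x))).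
Qed.

(* [hom x y] is the proposition x <= y, so there is exactly one arrow x -> y
   when x <= y (proofs of a proposition are equal) and none otherwise. *)
Definition space_category (X : topologicalType) : category := {|
  obj := X;
  hom := fun x y => space_le x y;
  idm := @space_le_refl X;
  comp := fun x y z yz xy => space_le_trans xy yz;
  comp_idl := fun x y _ => @Prop_irrelevance (space_le x y) _ _;
  comp_idr := fun x y _ => @Prop_irrelevance (space_le x y) _ _;
  comp_assoc := fun x y z t _ _ _ => @Prop_irrelevance (space_le x t) _ _
|}.

Definition space_functor (X Y : topologicalType) (p : continuousType X Y) :
    functor (space_category X) (space_category Y) :=
  @Functor (space_category X) (space_category Y) p
    (@space_le_continuous X Y p)
    (fun x => @Prop_irrelevance (space_le (p x) (p x)) _ _)
    (fun x y z _ _ => @Prop_irrelevance (space_le (p x) (p z)) _ _).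

Definition unit_interval (R : realType) : topologicalType :=
  set_type (`[0, 1]%classic : set R).

Lemma zero_in_unit_interval (R : realType) :
  (0 : R) \in (`[0, 1]%classic : set R).
Proof. by rewrite inE/= in_itv/= lexx ler01. Qed.

Definition I0 (R : realType) : unit_interval R :=
  exist _ 0 (zero_in_unit_interval R).

Definition hurewicz_fibration (R : realType) (E B : topologicalType)
    (p : continuousType E B) : Prop :=
  forall (X : topologicalType) (f : X -> E) (H : X * unit_interval R -> B),
    continuous f -> continuous H ->
    (forall x : X, H (x, I0 R) = p (f x)) ->
    exists Ht : X * unit_interval R -> E,
      [/\ continuous Ht, (forall x : X, Ht (x, I0 R) = f x)
        & (forall z, p (Ht z) = H z)].

Definition path_pullback (R : realType) (E B : topologicalType)
    (p : continuousType E B) : topologicalType :=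
  set_type [set eg : E * continuousType (unit_interval R) B |
    eg.2 (I0 R) = p eg.1].

Definition path_lifting_map (R : realType) (E B : topologicalType)
    (p : continuousType E B)
    (L : path_pullback R p -> continuousType (unit_interval R) E) : Prop :=
  continuous L /\
  forall z : path_pullback R p,
    L z (I0 R) = (val z).1 /\ forall t, p (L z t) = (val z).2 t.

Definition regular_path_lifting_map (R : realType) (E B : topologicalType)
    (p : continuousType E B)
    (L : path_pullback R p -> continuousType (unit_interval R) E) : Prop :=
  path_lifting_map L /\
  forall z : path_pullback R p,
    (forall t, (val z).2 t = p (val z).1) -> forall t, L z t = (val z).1.

(* Main.v *)
(* A continuous path-lifting map is monotone for the pointwise orders, and if it
   is regular it lifts constant paths to constant paths; so lifts of step paths
   are squeezed between points.  Write [L] for the path-lifting map.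
   If [b <= p e], let [g] be [p e] at [0] and [b] on ]0, 1]. For small [t > 0],
   [L (e, g) t] lies in the minimal open set of [e], and any [x <= e] with
   [p x <= b] satisfies [x = L (x, p x) t <= L (e, g) t].
   If [p e <= b], let [g] be [p e] on [0, 1[ and [b] at [1]. Then
   [e = L (e, p e) 1 <= L (e, g) 1], and any [x >= e] with [p x >= b] satisfies
   [L (e, g) 1 <= L (x, p x) 1 = x]. *)
Require Import Defs.
From mathcomp Require Import all_boot all_order all_algebra.
From mathcomp Require Import all_classical all_reals all_analysis.

Set Implicit Arguments.
Unset Strict Implicit.
Unset Printing Implicit Defensive.

Import Defs.
Import Order.TTheory GRing.Theory Num.Theory.
Import numFieldNormedType.Exports.
Import ArrowAsCompactOpen.

Local Open Scope classical_set_scope.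

(** Between parallel arrows all equations are automatic here, so [cartesian] only asks that
    factorisations exist: a cartesian lift is a greatest element among those below [e] with image
    below [b]. *)
Lemma thin_grothendieck_fibration (E B : category) (p : functor E B) :
  (forall (a b : E) (f g : hom a b), f = g) ->
  (forall (a b : B) (f g : hom a b), f = g) ->
  (forall (e : E) (b : B), hom b (p e) ->
    exists (e' : E) (_ : hom e' e), p e' = b /\
      forall x, hom x e -> hom (p x) b -> inhabited (hom x e')) ->
  grothendieck_fibration p.
Proof.
move=> thinE thinB lift e b f; have [e' [ft [pe' max_e']]] := lift e b f.
(* Once [b] is replaced by [p e'], [f] and [fmap p ft] have the same type and thinness identifies
   them. *)
move: f max_e'; rewrite -pe' => f max_e'.
exists e', ft; split; last by rewrite (thinB _ _ f (fmap p ft)).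
move=> x g h _; have [k] := max_e' x g h.
by exists k; split=> [|k' _]; [split; [exact: thinE|exact: thinB]|exact: thinE].
Qed.

(** The form used for path spaces, where [min_open] may fail to be open. *)
Lemma space_leP (X : topologicalType) (x y : X) :
  space_le x y <-> forall A, nbhs y A -> A x.
Proof.
split=> [xy A /nbhs_interior/nbhs_singleton Ay|xy z zx V [oV Vy]].
  apply: interior_subset; apply: (min_open_sub (@open_interior X A) Ay).
  exact: xy (@min_open_self X x).
by apply: (min_open_sub oV _ zx); apply: xy; exact: open_nbhs_nbhs.
Qed.

Lemma min_open_le (X : topologicalType) (x y : X) :
  min_open y x -> space_le x y.
Proof.
by move=> yx; apply/space_leP => A; rewrite nbhsE => -[V [oV Vy]]; apply;
   exact: yx.
Qed.

Lemma continuous_space_le (X Y : topologicalType) (f : X -> Y) (x y : X) :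
  continuous f -> space_le x y -> space_le (f x) (f y).
Proof.
by move=> cf /space_leP xy; apply/space_leP => A /cf /xy.
Qed.

(** Neighbourhoods in the initial topology contain preimages of open sets, so the order can be
    tested after [f]. This serves both subspaces and [continuousType]. *)
Lemma initial_space_le (S : choiceType) (T : topologicalType) (f : S -> T)
    (x y : initial_topology f) :
  space_le (f x) (f y) -> space_le x y.
Proof.
move=> /space_leP xy; apply/space_leP => A [_ [[V oV <-] Vy VA]].
by apply: VA; apply: xy; exact: open_nbhs_nbhs.
Qed.

Lemma prod_space_le (X Y : topologicalType) (x y : X * Y) :
  space_le x.1 y.1 -> space_le x.2 y.2 -> space_le x y.
Proof.
move=> /space_leP xy1 /space_leP xy2; apply/space_leP => A [[P Q] [/= yP yQ]].
by apply; split; [exact: xy1|exact: xy2].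
Qed.

Lemma pointwise_space_le (X Y : topologicalType) (f g : continuousType X Y) :
  (forall t, space_le (f t) (g t)) -> space_le f g.
Proof.
move=> fg; apply: (@initial_space_le _ _ (id : continuousType X Y -> (X -> Y))).
apply/space_leP.
(* The order is convergence of the principal filter at [f] to [g], which needs checking only on sets
   of maps sending a compact [K] into an open [V]. *)
suff : principal_filter (f : X -> Y) --> (g : {compact-open, X -> Y}).
  by move=> + A => /[apply] /principal_filterP.
apply/compact_open_cvgP => K V _ oV gKV; apply/principal_filterP => _ [t Kt <-].
by move/space_leP: (fg t); apply; apply: open_nbhs_nbhs; split=> //; apply: gKV;
   exists t.
Qed.

Lemma eval_space_le (X Y : topologicalType) (f g : continuousType X Y) t :
  space_le f g -> space_le (f t) (g t).
Proof.
move=> fg; apply/space_leP => A; rewrite nbhsE => -[V [oV Vgt] VA]; apply: VA.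
have /space_leP fg' : space_le (f : X -> Y) (g : X -> Y).
  by apply: (continuous_space_le _ fg); exact: initial_continuous.
(* As a singleton is compact, sending [t] into [V] is an open condition on maps. *)
have := fg' [set h : X -> Y | h @` [set t] `<=` V].
rewrite /= image_set1 sub1set inE; apply.
apply: open_nbhs_nbhs; split; last by rewrite /= image_set1 => _ ->.
by apply: compact_open_open => //; exact: compact_set1.
Qed.

(** An open set containing [b] contains [a], so its preimage is everything; the other possible
    preimages are [P] and the empty set. *)
Lemma continuous_step (T X : topologicalType) (P : pred T) (a b : X) :
  open [set t | P t] -> space_le a b ->
  continuous (fun t => if P t then a else b).
Proof.
move=> oP /space_leP ab; apply/continuousP => V oV.
have [Vb|nVb] := pselect (V b).
  have Va : V a by apply: ab; exact: open_nbhs_nbhs.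
  rewrite (_ : _ @^-1` _ = setT); first exact: openT.
  by apply/seteqP; split=> // t _ /=; case: ifP.
have [Va|nVa] := pselect (V a).
  rewrite (_ : _ @^-1` _ = [set t | P t])//.
  by apply/seteqP; split=> t /=; case: ifP.
rewrite (_ : _ @^-1` _ = set0); first exact: open0.
by apply/seteqP; split=> // t /=; case: ifP.
Qed.

Lemma unit_interval_near0 (R : realType) (U : set (unit_interval R)) :
  open U -> U (I0 R) -> exists2 t, U t & t != I0 R.
Proof.
move=> [V oV <-] V0; have /filter_ex[s [Vs s0 s1]] :
    \forall s \near (0 : R)^'+, [/\ V s, (0 < s)%R & (s < 1)%R].
  near=> s; split; near: s.
  - by apply: cvg_within; apply: open_nbhs_nbhs.
  - exact: nbhs_right_gt.
  - exact: nbhs_right_lt.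
have Is : s \in `[0%R, 1%R]%classic by rewrite inE/= in_itv/= !ltW.
exists (exist _ s Is) => //; apply/eqP => /(congr1 val)/= s0'.
by rewrite s0' ltxx in s0.
Unshelve. all: by end_near. Qed.

Lemma open_unit_interval_neq (R : realType) (u : unit_interval R) :
  open [set t | t != u].
Proof.
exists (~` [set val u]); first exact: closed_openC (@closed_eq R (val u)).
by apply/seteqP; split=> t /= tu; [apply: contra_notN tu => /eqP ->|
  move=> /val_inj tu'; rewrite tu' eqxx in tu].
Qed.

(** The smaller value must sit on the open complement of [u]; downward lifts use [u = 0], upward
    ones [u = 1]. *)
Lemma step_path (R : realType) (X : topologicalType) (u : unit_interval R)
    (a b : X) :
  space_le a b -> exists g : continuousType (unit_interval R) X,
    forall t, g t = if t != u then a else b.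
Proof.
move=> ab; have g_cont := continuous_step (@open_unit_interval_neq R u) ab.
by exists (mkcts g_cont).
Qed.

Section regular_path_lifting.
Context (R : realType) (E B : topologicalType) (p : continuousType E B).
Variable L : path_pullback R p -> continuousType (unit_interval R) E.
Hypothesis regL : regular_path_lifting_map L.

Lemma path_lifting_le (z z' : path_pullback R p) t :
  space_le (val z).1 (val z').1 ->
  (forall s, space_le ((val z).2 s) ((val z').2 s)) ->
  space_le (L z t) (L z' t).
Proof.
move=> zz'1 zz'2; apply: eval_space_le.
apply: continuous_space_le regL.1.1 _.
apply: (@initial_space_le _ _ set_val).
by apply: prod_space_le => //; exact: pointwise_space_le.
Qed.

Definition pullback_pair (e : E) (g : continuousType (unit_interval R) B)
    (g0 : g (I0 R) = p e) : path_pullback R p :=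
  exist _ (e, g) (mem_set (g0 : [set eg : E * continuousType (unit_interval R) B |
    eg.2 (I0 R) = p eg.1] (e, g))).

Definition pullback_cst (e : E) : path_pullback R p :=
  @pullback_pair e (mkcts (@cst_continuous (unit_interval R) B (p e))) erefl.

Lemma lift_cst (e : E) t : L (pullback_cst e) t = e.
Proof. by rewrite regL.2. Qed.

Lemma le_lift (e : E) (z : path_pullback R p) t :
  space_le e (val z).1 -> (forall s, space_le (p e) ((val z).2 s)) ->
  space_le e (L z t).
Proof. by move=> *; rewrite -[e](lift_cst e t); exact: path_lifting_le. Qed.

Lemma lift_le (e : E) (z : path_pullback R p) t :
  space_le (val z).1 e -> (forall s, space_le ((val z).2 s) (p e)) ->
  space_le (L z t) e.
Proof. by move=> *; rewrite -[e](lift_cst e t); exact: path_lifting_le. Qed.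

Lemma regular_lift_down (e : E) (b : B) :
  finite_set [set: E] -> space_le b (p e) ->
  exists e', [/\ space_le e' e, p e' = b &
    forall x, space_le x e -> space_le (p x) b -> space_le x e'].
Proof.
move=> finE bpe; have [g gE] := step_path (I0 R) bpe.
have g0 : g (I0 R) = p e by rewrite gE eqxx.
pose z := pullback_pair g0.
(* Finiteness of [E] makes [min_open e] open, so the lift stays in it for some [t > 0], where the
   path already has the value [b]. *)
have Lz_open : open (L z @^-1` min_open e).
  by apply: open_comp => [t _|]; [exact: cts_fun|exact: open_min_open].
have [|t Lzt t0] := unit_interval_near0 Lz_open.
  by rewrite /= (regL.1.2 z).1; exact: min_open_self.
exists (L z t); split; first exact: min_open_le.
  by rewrite (regL.1.2 z).2/= gE t0.
move=> x xe pxb; apply: le_lift => //= s; rewrite gE; case: ifP => // _.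
exact: space_le_trans pxb bpe.
Qed.

Lemma regular_lift_up (e : E) (b : B) : space_le (p e) b ->
  exists e', [/\ space_le e e', p e' = b &
    forall x, space_le e x -> space_le b (p x) -> space_le e' x].
Proof.
move=> peb.
have I1_proof : (1 : R)%R \in `[0%R, 1%R]%classic.
  by rewrite inE/= in_itv/= lexx ler01.
pose I1 : unit_interval R := exist _ 1%R I1_proof.
have [g gE] := step_path I1 peb.
have g0 : g (I0 R) = p e.
  rewrite gE ifT//; apply/eqP => -[/esym/eqP].
  by rewrite oner_eq0.
pose z := pullback_pair g0.
exists (L z I1); split.
- apply: le_lift => //= s; rewrite gE.
  by case: ifP => // _; exact: space_le_refl.
- by rewrite (regL.1.2 z).2/= gE eqxx.
- move=> x ex bpx; apply: lift_le => //= s; rewrite gE; case: ifP => // _.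
  exact: space_le_trans peb bpx.
Qed.

End regular_path_lifting.

Theorem theorem6p20 (R : realType) (E B : topologicalType)
    (finE : finite_set [set: E]) (finB : finite_set [set: B])
    (T0E : kolmogorov_space E) (T0B : kolmogorov_space B)
    (E_nonempty : [set: E] !=set0)
    (p : continuousType E B)
    (p_fib : hurewicz_fibration R p)
    (p_reg : exists L : path_pullback R p -> continuousType (unit_interval R) E,
        regular_path_lifting_map L) :
  grothendieck_bifibration (space_functor p).
Proof.
have [L regL] := p_reg; split; apply: thin_grothendieck_fibration.
- by move=> x y; exact: (@Prop_irrelevance (space_le x y)).
- by move=> x y; exact: (@Prop_irrelevance (space_le x y)).
- move=> e b /(regular_lift_down regL finE)[e' [e'e pe' max_e']].
  by exists e', e'e; split=> // x xe pxb; constructor; exact: max_e'.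
(* Arrows of the opposite category reverse the order, so greatest lifts become least ones. *)
- by move=> x y; exact: (@Prop_irrelevance (space_le y x)).
- by move=> x y; exact: (@Prop_irrelevance (space_le y x)).
- move=> e b /(regular_lift_up regL)[e' [ee' pe' min_e']].
  by exists e', ee'; split=> // x ex bpx; constructor; exact: min_e'.
Qed.
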